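(* Let $\mathbf{A}\in\mathbb{H}^{n\times n}$ be a Hermitian quaternion matrix with $\mathrm{Ind}\,\mathbf{A}=k$ and $\operatorname{rank}\mathbf{A}^{k+1}=\operatorname{rank}\mathbf{A}^{k}=r$ (with $r\ge 1$). Then the entries of the Drazin inverse $\mathbf{A}^{D}=(a_{ij}^{D})\in\mathbb{H}^{n\times n}$ admit, for all $i,j=1,\dots,n$, both of the following representations: $$a_{ij}^{D}=\frac{\sum_{\beta\in J_{r,n}\{i\}}\mathrm{cdet}_{i}\left(\left(\mathbf{A}^{k+1}\right)_{.i}\left(\mathbf{a}_{.j}^{(k)}\right)\right)_{\beta}^{\beta}}{\sum_{\beta\in J_{r,n}}\left|\left(\mathbf{A}^{k+1}\right)_{\beta}^{\beta}\right|}$$ and $$a_{ij}^{D}=\frac{\sum_{\alpha\in I_{r,n}\{j\}}\mathrm{rdet}_{j}\left(\left(\mathbf{A}^{k+1}\right)_{j.}\left(\mathbf{a}_{i.}^{(k)}\right)\right)_{\alpha}^{\alpha}}{\sum_{\alpha\in I_{r,n}}\left|\left(\mathbf{A}^{k+1}\right)_{\alpha}^{\alpha}\right|}.$$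
   Context: $\mathbb{H}$ is the skew field of real quaternions; $\mathbf{A}^{*}$ is the conjugate transpose and $\mathbf{A}$ is Hermitian if $\mathbf{A}^*=\mathbf{A}$. The rank of a quaternion matrix is the maximal number of right-linearly independent columns (equivalently, of left-linearly independent rows). Index and Drazin inverse: $\mathrm{Ind}\,\mathbf{A}$ is the least integer $k\ge 0$ with $\operatorname{rank}\mathbf{A}^{k+1}=\operatorname{rank}\mathbf{A}^{k}$ ($\mathbf{A}^0=\mathbf{I}$). For $k=\mathrm{Ind}\,\mathbf{A}$, the Drazin inverse $\mathbf{A}^D$ is the unique matrix $\mathbf{X}$ with $\mathbf{A}^{k+1}\mathbf{X}=\mathbf{A}^{k}$, $\mathbf{X}\mathbf{A}\mathbf{X}=\mathbf{X}$, $\mathbf{A}\mathbf{X}=\mathbf{X}\mathbf{A}$. Row and column determinants of $\mathbf{M}=(m_{pq})\in\mathbb{H}^{n\times n}$: Row determinant: given $i$, write each permutation $\sigma\in S_n$ as a product of disjoint cycles (including cycles of length one) $C_1C_2\cdots C_r$, where $C_1$ is the cycle containing $i$ and is written starting with $i$, each $C_t$ with $t\ge2$ is written starting with its smallest element, and the first elements of $C_2,\dots,C_r$ are increasing. For a cycle $C=(c_0\,c_1\dots c_l)$ set $m_C=m_{c_0c_1}m_{c_1c_2}\cdots m_{c_lc_0}$. Then $\mathrm{rdet}_i\mathbf{M}=\sum_{\sigma\in S_n}(-1)^{n-r}m_{C_1}m_{C_2}\cdots m_{C_r}$, where $r=r(\sigma)$ is the number of cycles. Column determinant: given $j$, write each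 $\tau\in S_n$ as a product of disjoint cycles $C_r\cdots C_2C_1$, each written as $C=(c_l\dots c_1\,c_0)$, where $C_1$ contains $j$ and has $c_0=j$ as last element, each $C_t$ with $t\ge2$ has its smallest element $c_0$ last, and these last elements increase with $t=2,\dots,r$. Set $m'_C=m_{c_0c_l}m_{c_lc_{l-1}}\cdots m_{c_1c_0}$. Then $\mathrm{cdet}_j\mathbf{M}=\sum_{\tau\in S_n}(-1)^{n-r}m'_{C_r}\cdots m'_{C_2}m'_{C_1}$. For a Hermitian matrix all row and column determinants coincide and are real; their common value is the determinant $\det\mathbf{M}=|\mathbf{M}|$. Notation: $\mathbf{a}_{.j}^{(m)}$ and $\mathbf{a}_{i.}^{(m)}$ are the $j$th column and $i$th row of $\mathbf{A}^m$. $\mathbf{M}_{.i}(\mathbf{b})$ (resp. $\mathbf{M}_{j.}(\mathbf{b})$) is $\mathbf{M}$ with its $i$th column replaced by the column $\mathbf{b}$ (resp. its $j$th row replaced by the row $\mathbf{b}$). $\mathbf{M}_\beta^\beta$ is the principal submatrix with rows and columns indexed by $\beta$; its rows and columns keep their original labels, so $\mathrm{cdet}_i(\mathbf{M}_\beta^\beta)$ and $\mathrm{rdet}_i(\mathbf{M}_\beta^\beta)$ ($i\in\beta$) refer to the column/row originally labelled $i$. For $1\le s\le n$, $I_{s,n}=J_{s,n}$ is the set of all strictly increasing sequences (subsets) of $s$ integers from $\{1,\dots,n\}$, and $I_{s,n}\{i\}=J_{s,n}\{i\}$ is the subset of those containing $i$. *)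

(* Defs.v *)
From HB Require Import structures.
From mathcomp Require Export all_boot all_order all_algebra all_fingroup.
From mathcomp Require Import ring lra.
From mathcomp Require Export boolp classical_sets reals.

Set Implicit Arguments.
Unset Strict Implicit.
Unset Printing Implicit Defensive.

Import Order.TTheory GRing.Theory Num.Theory.
Local Open Scope ring_scope.

(* Quat a b c d stands for a + b i + c j + d k, with i j = k = - j i. *)
Record quat (R : realType) : Type := Quat { qre : R; qi : R; qj : R; qk : R }.

Section Quaternions.
Variable R : realType.
Implicit Types x y z : quat R.

Definition tuple_of_quat x := (qre x, qi x, qj x, qk x).
Definition quat_of_tuple (t : R * R * R * R) : quat R :=
  let: (a, b, c, d) := t in Quat a b c d.

Lemma tuple_of_quatK : cancel tuple_of_quat quat_of_tuple.
Proof. by case. Qed.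

HB.instance Definition _ := Choice.copy (quat R) (can_type tuple_of_quatK).

Definition addq x y :=
  Quat (qre x + qre y) (qi x + qi y) (qj x + qj y) (qk x + qk y).

Definition oppq x := Quat (- qre x) (- qi x) (- qj x) (- qk x).

Definition mulq x y :=
  Quat (qre x * qre y - qi x * qi y - qj x * qj y - qk x * qk y)
       (qre x * qi y + qi x * qre y + qj x * qk y - qk x * qj y)
       (qre x * qj y - qi x * qk y + qj x * qre y + qk x * qi y)
       (qre x * qk y + qi x * qj y - qj x * qi y + qk x * qre y).

Definition qreal (a : R) := Quat a 0 0 0.

Definition qconj x := Quat (qre x) (- qi x) (- qj x) (- qk x).

Definition qnorm2 x := qre x ^+ 2 + qi x ^+ 2 + qj x ^+ 2 + qk x ^+ 2.

Definition invq x := mulq (qreal (qnorm2 x)^-1) (qconj x).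

Lemma addqA : associative addq.
Proof. by move=> x y z; rewrite /addq /=; congr Quat; ring. Qed.

Lemma addqC : commutative addq.
Proof. by move=> x y; rewrite /addq /=; congr Quat; ring. Qed.

Lemma add0q : left_id (qreal 0) addq.
Proof. by case=> a b c d; rewrite /addq /=; congr Quat; ring. Qed.

Lemma addNq : left_inverse (qreal 0) oppq addq.
Proof. by case=> a b c d; rewrite /addq /oppq /=; congr Quat; ring. Qed.

HB.instance Definition _ :=
  GRing.isZmodule.Build (quat R) addqA addqC add0q addNq.

Lemma mulqA : associative mulq.
Proof. by move=> x y z; rewrite /mulq /=; congr Quat; ring. Qed.

Lemma mul1q : left_id (qreal 1) mulq.
Proof. by case=> a b c d; rewrite /mulq /=; congr Quat; ring. Qed.

Lemma mulq1 : right_id (qreal 1) mulq.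
Proof. by case=> a b c d; rewrite /mulq /=; congr Quat; ring. Qed.

Lemma mulqDl : left_distributive mulq +%R.
Proof.
by move=> x y z; rewrite /GRing.add /= /addq /mulq /=; congr Quat; ring.
Qed.

Lemma mulqDr : right_distributive mulq +%R.
Proof.
by move=> x y z; rewrite /GRing.add /= /addq /mulq /=; congr Quat; ring.
Qed.

Lemma oneq_neq0 : qreal 1 != 0.
Proof. by apply/eqP => -[] /eqP; rewrite oner_eq0. Qed.

HB.instance Definition _ :=
  GRing.Zmodule_isNzRing.Build (quat R) mulqA mul1q mulq1 mulqDl mulqDr oneq_neq0.

Lemma qnorm2_eq0 x : (qnorm2 x == 0) = (x == 0).
Proof.
case: x => a b c d; apply/eqP/eqP => [|[-> -> -> ->]].
  rewrite /qnorm2 /= => /eqP.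
  by rewrite !paddr_eq0 ?addr_ge0 ?sqr_ge0 // !sqrf_eq0
     => /andP[/andP[/andP[/eqP-> /eqP->] /eqP->] /eqP->].
by rewrite /qnorm2 /= expr0n !addr0.
Qed.

Lemma mulVq : {in [pred x | x != 0], left_inverse 1 invq *%R}.
Proof.
move=> x; rewrite inE -qnorm2_eq0; case: x => a b c d; rewrite /qnorm2 /= => h.
by rewrite /GRing.mul /= /mulq /invq /qnorm2 /=; congr Quat; field.
Qed.

Lemma mulqV : {in [pred x | x != 0], right_inverse 1 invq *%R}.
Proof.
move=> x; rewrite inE -qnorm2_eq0; case: x => a b c d; rewrite /qnorm2 /= => h.
by rewrite /GRing.mul /= /mulq /invq /qnorm2 /=; congr Quat; field.
Qed.

Lemma unitqP x y : y * x = 1 /\ x * y = 1 -> x != 0.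
Proof.
by case=> yx1 _; apply: contra_eqN yx1 => /eqP ->; rewrite mulr0 eq_sym oner_eq0.
Qed.

Lemma invq_out : {in [predC [pred x | x != 0]], invq =1 id}.
Proof.
move=> x; rewrite !inE negbK => /eqP ->.
by rewrite /invq /mulq /=; congr Quat; ring.
Qed.

HB.instance Definition _ :=
  GRing.NzRing_hasMulInverse.Build (quat R) mulVq mulqV unitqP invq_out.

End Quaternions.

Section QuaternionMatrices.
Variable R : realType.
Local Notation H := (quat R).

Definition conjtr m n (A : 'M[H]_(m, n)) : 'M[H]_(n, m) :=
  (map_mx (@qconj R) A)^T.

Definition hermitian n (A : 'M[H]_n) : Prop := conjtr A = A.

(* A *m c is the combination of the columns of A with coefficients c acting
   on the right. *)
Definition right_indep_cols m n (A : 'M[H]_(m, n)) (S : {set 'I_n}) : Prop :=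
  forall c : 'cV[H]_n,
    (forall j, j \notin S -> c j 0 = 0) -> A *m c = 0 -> c = 0.

Definition qrank m n (A : 'M[H]_(m, n)) : nat :=
  \max_(S : {set 'I_n} | `[< right_indep_cols A S >]) #|S|.

Definition is_qindex n (A : 'M[H]_n) (k : nat) : Prop :=
  qrank (A ^+ k.+1) = qrank (A ^+ k) /\
  forall l, qrank (A ^+ l.+1) = qrank (A ^+ l) -> (k <= l)%N.

(* Some k satisfies is_qindex A, and exactly one X satisfies is_drazin A, so
   the default values of xget are never used below. *)
Definition qindex n (A : 'M[H]_n) : nat := xget 0%N (is_qindex A).

Definition is_drazin n (A X : 'M[H]_n) : Prop :=
  let k := qindex A in
  [/\ A ^+ k.+1 *m X = A ^+ k, X *m A *m X = X & A *m X = X *m A].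

Definition drazin n (A : 'M[H]_n) : 'M[H]_n := xget 0 (is_drazin A).

(* The product m_(c0 c1) m_(c1 c2) ... m_(cl c0) for c = [:: c0; c1; ...; cl]. *)
Definition cycle_prod n (M : 'M[H]_n) (c : seq 'I_n) : H :=
  \prod_(p <- zip c (rot 1 c)) M p.1 p.2.

(* The cycles C_1, C_2, ... of a permutation s of beta: first the one of i,
   written from i, then the others, each written from its smallest element, in
   increasing order of these (enum beta is increasing).  fingraph.orbit s x is
   [:: x; s x; s (s x); ...]. *)
Definition cycles_from n (beta : {set 'I_n}) (i : 'I_n) (s : {perm 'I_n}) :
    seq (seq 'I_n) :=
  fingraph.orbit s i ::
  [seq fingraph.orbit s x | x <- enum beta
     & (x \notin fingraph.orbit s i) &&
       all (fun y : 'I_n => x <= y)%N (fingraph.orbit s x)].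

(* Principal submatrices keep the labels of M: rdet beta i M and cdet beta i M
   are rdet_i and cdet_i of M_beta^beta, for i in beta, and the permutations of
   beta are those of 'I_n with support in beta. *)
Definition rdet n (beta : {set 'I_n}) (i : 'I_n) (M : 'M[H]_n) : H :=
  \sum_(s : {perm 'I_n} | perm_on beta s)
    let C := cycles_from beta i s in
    (-1) ^+ (#|beta| - size C) * \prod_(c <- C) cycle_prod M c.

(* A cycle written (c_l ... c_1 c_0) maps c_0 to c_l, so that it is c_0 followed
   by c_l, ..., c_1 as an orbit, and m_(c0 cl) ... m_(c1 c0) is the cycle_prod
   of that orbit; only the order of the cycles is reversed. *)
Definition cdet n (beta : {set 'I_n}) (j : 'I_n) (M : 'M[H]_n) : H :=
  \sum_(s : {perm 'I_n} | perm_on beta s)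
    let C := cycles_from beta j s in
    (-1) ^+ (#|beta| - size C) * \prod_(c <- rev C) cycle_prod M c.

(* The determinant of M_beta^beta: the common real value of its row and column
   determinants (meant for M Hermitian and beta nonempty). *)
Definition hdet n (beta : {set 'I_n}) (M : 'M[H]_n) : R :=
  xget 0 (fun d : R => forall i, i \in beta ->
    rdet beta i M = qreal d /\ cdet beta i M = qreal d).

Definition replace_col n (M : 'M[H]_n) (i : 'I_n) (b : 'cV[H]_n) : 'M[H]_n :=
  \matrix_(p, q) if q == i then b p 0 else M p q.

Definition replace_row n (M : 'M[H]_n) (j : 'I_n) (b : 'rV[H]_n) : 'M[H]_n :=
  \matrix_(p, q) if p == j then b 0 q else M p q.

End QuaternionMatrices.

(* Main.v *)
From HB Require Import structures.
Require Import Defs.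
From mathcomp Require Import fintype finset ring lra.

(* Write [M = A^(k+1)].  Expanding [cdet_i] along the cycle through [i] gives,
   for each set [beta], an adjugate of the principal submatrix [M_beta], and for
   Hermitian [M] this adjugate is Hermitian and its product with [M_beta] is
   [det(M_beta) I].  Let [d_s] be the sum of the principal minors of order [s]
   and [L_s] the sum of the corresponding adjugates.  Then
   [L_(s+1) = d_s I - L_s M], as if both came from expanding the adjugate and
   the determinant of [t I + M] in powers of [t], and
   [Re tr L_(s+1) = (n - s) d_s].  Let [s] be the largest index with
   [d_s <> 0].  As [L_(n+1) = 0], [L_(s+1)] annihilates a power of [M], hence
   [A], since [A] is Hermitian; this gives the existence of [A^D] as well.  With
   [P = A^k (A^D)^k], the projection onto the range of [A^k], we get
   [L_(s+1) = d_s (I - P)], and taking traces yields [s = rank A^k = r].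
   Finally [L_(r+1) A = 0] reads [d_r A = L_r M A], whence
   [d_r A^D = L_r A^k], which is the column formula; conjugation gives the row
   formula. *)

Set Implicit Arguments.
Unset Strict Implicit.
Unset Printing Implicit Defensive.

Import Order.TTheory GRing.Theory Num.Theory.
Local Open Scope ring_scope.

(** * Quaternion conjugation, real parts and the central reals *)

Section QuaternionTheory.
Variable R : realType.
Implicit Types (x y : quat R) (a b : R).

Lemma qreal_is_zmod_morphism : zmod_morphism (@qreal R).
Proof. by move=> a b; congr Quat; rewrite /= ?oppr0 ?addr0. Qed.

Lemma qreal_is_monoid_morphism : monoid_morphism (@qreal R).
Proof. by split=> // a b; congr Quat; rewrite /=; ring. Qed.

HB.instance Definition _ :=
  GRing.isZmodMorphism.Build R (quat R) (@qreal R) qreal_is_zmod_morphism.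
HB.instance Definition _ :=
  GRing.isMonoidMorphism.Build R (quat R) (@qreal R) qreal_is_monoid_morphism.

Lemma qconj_is_zmod_morphism : zmod_morphism (@qconj R).
Proof. by move=> x y; congr Quat; rewrite /=; ring. Qed.

HB.instance Definition _ :=
  GRing.isZmodMorphism.Build (quat R) (quat R) (@qconj R) qconj_is_zmod_morphism.

Lemma qre_is_zmod_morphism : zmod_morphism (@qre R).
Proof. by move=> x y. Qed.

HB.instance Definition _ :=
  GRing.isZmodMorphism.Build (quat R) R (@qre R) qre_is_zmod_morphism.

Lemma qrealC a x : qreal a * x = x * qreal a.
Proof. by congr Quat; rewrite /=; ring. Qed.

Lemma qreal_inj : injective (@qreal R).
Proof. by move=> a b []. Qed.

Lemma qconjK : involutive (@qconj R).
Proof. by case=> a b c d; rewrite /qconj /= !opprK. Qed.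

Lemma qconjM x y : qconj (x * y) = qconj y * qconj x.
Proof. by congr Quat; rewrite /=; ring. Qed.

Lemma qconj_real a : qconj (qreal a) = qreal a.
Proof. by rewrite /qconj /= !oppr0. Qed.

Lemma qconj_fixed x : qconj x = x -> x = qreal (qre x).
Proof.
case: x => a b c d [hb hc hd]; rewrite /qreal /=.
by congr Quat; lra.
Qed.

(** The real part is cyclic although the product is not commutative; this makes [retr] cyclic
    below. *)
Lemma qre_mulC x y : qre (x * y) = qre (y * x).
Proof. by rewrite /=; ring. Qed.

Lemma qconj_prod_rev (I : Type) (s : seq I) (F : I -> quat R) :
  qconj (\prod_(t <- s) F t) = \prod_(t <- rev s) qconj (F t).
Proof.
elim: s => [|t s IH]; first by rewrite !big_nil qconj_real.
by rewrite big_cons qconjM IH rev_cons big_rcons.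
Qed.

End QuaternionTheory.

(** * Expansion of a column determinant along one cycle *)

Section Orbits.
Variable T : finType.
Implicit Types (s : {perm T}) (x y i q : T).

Lemma fcycle_orbit (f : T -> T) x c :
  fcycle f (x :: c) -> uniq (x :: c) -> fingraph.orbit f x = x :: c.
Proof.
move=> fc uc; rewrite (fingraph.orbitE fc uc (mem_head _ _)) /= eqxx.
by rewrite rot0.
Qed.

Lemma mem_orbit_sym s x y : (y \in fingraph.orbit s x) = (x \in fingraph.orbit s y).
Proof. by rewrite -!fconnect_orbit (fconnect_sym perm_inj). Qed.

Lemma orbit_fixed s x : s x = x -> fingraph.orbit s x = [:: x].
Proof. by move=> sx; apply: fcycle_orbit => //=; rewrite sx eqxx. Qed.

Lemma orbit_cons (f : T -> T) x : exists c, fingraph.orbit f x = x :: c.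
Proof. by rewrite /fingraph.orbit -orderSpred /=; eexists. Qed.

(* Multiplying by [tperm i q] inserts the fixed point [i] in front of [q]. *)
Lemma orbit_insert s i q : s i = i -> i != q ->
  fingraph.orbit (s * tperm i q)%g i = i :: fingraph.orbit s q.
Proof.
move=> si iq; have iNq : i \notin fingraph.orbit s q.
  by rewrite mem_orbit_sym orbit_fixed // inE eq_sym.
have := orbit_uniq s q; have := cycle_orbit (@perm_inj _ s) q.
have [c Ec] := orbit_cons s q; rewrite {}Ec in iNq * => cyc uq.
apply: fcycle_orbit; last by rewrite /= iNq.
move: cyc uq iNq; rewrite /= permM si tpermL eqxx /= => + /andP[qc _] iNqc.
rewrite inE negb_or iq /= in iNqc.
suff all_x x : fpath s x (rcons c q) -> fpath (s * tperm i q)%g x (rcons c i).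
  exact: all_x.
elim: c x qc iNqc => [|y c IH] x qc ic /=.
  by rewrite permM => /andP[/eqP -> _]; rewrite tpermR eqxx.
move: qc ic; rewrite !inE !negb_or => /andP[qy qc] /andP[iy ic] /andP[/eqP sx p].
by rewrite permM sx tpermD // eqxx IH.
Qed.

(** Composing with [tperm i q] only affects points whose image is [i] or [q], and the orbit of [x]
    contains neither. *)
Lemma orbit_insert_other s i q x : s i = i -> x != i ->
  x \notin fingraph.orbit s q ->
  fingraph.orbit (s * tperm i q)%g x = fingraph.orbit s x.
Proof.
move=> si xi; rewrite mem_orbit_sym => qNx.
have iNx : i \notin fingraph.orbit s x by rewrite mem_orbit_sym orbit_fixed // inE.
have := orbit_uniq s x; have := cycle_orbit (@perm_inj _ s) x.
have [c Ec] := orbit_cons s x; rewrite {}Ec in iNx qNx * => cyc ux.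
apply: fcycle_orbit => //.
suff sub : {in predC (pred2 i q) &, frel s =2 frel (s * tperm i q)%g}.
  rewrite /= -(eq_in_path sub) //=.
  move: iNx qNx; rewrite !inE !negb_or all_rcons /=.
  move=> /andP[ix ic] /andP[qx qc].
  rewrite [x == i]eq_sym [x == q]eq_sym (negbTE ix) (negbTE qx) /=.
  apply/allP => y yc; rewrite !inE negb_or.
  by apply/andP; split; [apply: contraNneq ic | apply: contraNneq qc] => <-.
move=> y z _; rewrite !inE negb_or => /andP[zi zq] /=; rewrite permM.
apply/eqP/eqP => [->|]; first by rewrite tpermD // eq_sym.
by move=> /(canRL (tpermK _ _)) ->; rewrite tpermD // eq_sym.
Qed.

(** Permutations are sorted by the image [q] of [i]; composing with the involution [tperm i q] makes
    [i] a fixed point. The term [q = i] collects those that already fix [i]. *)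
Lemma sum_perm_insert (V : nmodType) (beta : {set T}) i (F : {perm T} -> V) :
  i \in beta ->
  \sum_(s | perm_on beta s) F s =
  \sum_(q in beta) \sum_(s | perm_on (beta :\ i) s) F (s * tperm i q)%g.
Proof.
move=> ib; rewrite (partition_big (fun s : {perm T} => s i) (mem beta)) /=; last first.
  by move=> s sb; rewrite (perm_closed i sb).
apply: eq_bigr => q qb.
have tb : perm_on beta (tperm i q).
  apply: (subset_trans (tperm_on i q)).
  by apply/subsetP => x; rewrite !inE => /orP[] /eqP ->.
rewrite (reindex (fun s : {perm T} => (s * tperm i q)%g)) /=; last first.
  by exists (fun s : {perm T} => (s * tperm i q)%g) => s _; rewrite -mulgA tperm2 mulg1.
apply: eq_bigl => s; apply/andP/idP => [[sb /eqP si]|sb].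
  have {}sb : perm_on beta s by rewrite -(mulg1 s) -(tperm2 i q) mulgA perm_onM.
  have {}si : s i = i by apply: (perm_inj (s := tperm i q)); rewrite -permM si tpermL.
  apply/subsetP => x xs; rewrite !inE (subsetP sb) // andbT.
  by apply: contraTneq xs => ->; rewrite inE si eqxx.
have sb' : perm_on beta s by apply: (subset_trans sb); apply: subD1set.
split; first exact: perm_onM.
by rewrite permM (out_perm sb) ?tpermL // !inE eqxx.
Qed.

End Orbits.

Section PathExpansion.
Variables (R : realType) (n : nat).
Local Notation H := (quat R).
Implicit Types (M : 'M[H]_n) (b : 'I_n -> H) (beta : {set 'I_n}) (s : {perm 'I_n}).

Definition orbit_min s (x : 'I_n) :=
  all (fun y : 'I_n => x <= y)%N (fingraph.orbit s x).

Definition all_cycles beta s :=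
  [seq fingraph.orbit s x | x <- enum beta & orbit_min s x].

Definition other_cycles beta i s :=
  [seq fingraph.orbit s x | x <- enum beta
    & (x \notin fingraph.orbit s i) && orbit_min s x].

(** A determinant with no distinguished index, every cycle starting from its smallest element; it
    makes sense for the empty set too. *)
Definition perm_det beta M : H :=
  \sum_(s : {perm 'I_n} | perm_on beta s)
    (-1) ^+ (#|beta| - size (all_cycles beta s)) *
    \prod_(c <- rev (all_cycles beta s)) cycle_prod M c.

(** A cycle product whose closing entry, the one in the replaced column, is given by [b]. *)
Fixpoint chain_prod M b (c : seq 'I_n) : H :=
  match c with
  | [::] => 1
  | x :: c' => if c' is y :: _ then M x y * chain_prod M b c' else b x
  end.

(* [cdet beta i] of [M] with column [i] replaced by [b], and [z] inserted in
   front of the cycle through [i].  In the recursion [z] collects the entries of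
   that cycle already read, as the other cycles multiply from its left. *)
Definition cdet_insert M beta i (z : H) b : H :=
  \sum_(s : {perm 'I_n} | perm_on beta s)
    (-1) ^+ (#|beta| - (size (other_cycles beta i s)).+1) *
    (\prod_(c <- rev (other_cycles beta i s)) cycle_prod M c) * z *
    chain_prod M b (fingraph.orbit s i).

(** The elements of the cycle are distinct, so only its closing entry lies in column [i]. *)
Lemma cycle_prod_chain M b i c (N : 'M[H]_n) :
  (forall x y, N x y = if y == i then b x else M x y) ->
  uniq (i :: c) -> cycle_prod N (i :: c) = chain_prod M b (i :: c).
Proof.
move=> NE /= /andP[ic _]; rewrite /cycle_prod rot1_cons.
suff all_x x : \prod_(p <- zip (x :: c) (rcons c i)) N p.1 p.2 = chain_prod M b (x :: c).
  exact: all_x.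
elim: c x ic => [|y c IH] x ic; first by rewrite /= big_seq1 /= NE eqxx.
move: ic; rewrite inE negb_or => /andP[iy ic].
by rewrite rcons_cons [zip _ _]/= big_cons IH //= NE eq_sym (negbTE iy).
Qed.

Lemma eq_cycle_prod_notin M (N : 'M[H]_n) i c :
  (forall x y, y != i -> N x y = M x y) ->
  i \notin c -> cycle_prod N c = cycle_prod M c.
Proof.
move=> NE ic; rewrite /cycle_prod; apply: eq_big_seq => -[x y] xy /=; apply: NE.
apply: contraNneq ic => <-; rewrite -(mem_rot 1).
have -> : rot 1 c = unzip2 (zip c (rot 1 c)) by rewrite unzip2_zip // size_rot.
exact: (map_f snd xy).
Qed.

Lemma cdet_replace_col M beta i (b : 'cV[H]_n) :
  cdet beta i (replace_col M i b) = cdet_insert M beta i 1 (fun p => b p 0).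
Proof.
apply: eq_bigr => s sb /=; rewrite rev_cons big_rcons /= mulr1 -mulrA.
congr (_ * (_ * _)).
- apply: eq_big_seq => c; rewrite mem_rev => /mapP[x].
  rewrite mem_filter => /andP[/andP[xi _] _] ->.
  apply: (@eq_cycle_prod_notin _ _ i) => [u v vi|].
    by rewrite mxE (negbTE vi).
  by rewrite mem_orbit_sym.
- have := orbit_uniq s i; have [c ->] := orbit_cons s i => uc.
  by apply: cycle_prod_chain => // x y; rewrite mxE.
Qed.

Lemma filter_enum (T : finType) (p : pred T) (A : {set T}) :
  [seq x <- enum A | p x] = [seq x <- enum T | (x \in A) && p x].
Proof.
rewrite {1}/enum_mem enumT -filter_predI; apply: eq_filter => x.
by rewrite /= andbC.
Qed.

Lemma mem_orbit_on beta s x y :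
  perm_on beta s -> x \in beta -> y \in fingraph.orbit s x -> y \in beta.
Proof.
move=> sb xb; rewrite -fconnect_orbit => /iter_findex <-.
by elim: (findex _ _ _) => //= m; rewrite (perm_closed _ sb).
Qed.

Lemma other_cycles_fixed beta i s :
  perm_on (beta :\ i) s -> other_cycles beta i s = all_cycles (beta :\ i) s.
Proof.
move=> sb; have si : s i = i by rewrite (out_perm sb) // !inE eqxx.
rewrite /other_cycles /all_cycles !filter_enum orbit_fixed //.
by congr map; apply: eq_filter => x; rewrite !inE; do !case: (_ \in _) (_ == _) => [] [].
Qed.

Lemma other_cycles_insert beta i q s :
  perm_on (beta :\ i) s -> q \in beta :\ i ->
  other_cycles beta i (s * tperm i q)%g = other_cycles (beta :\ i) q s.
Proof.
move=> sb qb; have si : s i = i by rewrite (out_perm sb) // !inE eqxx.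
have iq : i != q by move: qb; rewrite !inE eq_sym => /andP[].
rewrite /other_cycles !filter_enum.
have -> : [seq x <- enum 'I_n | (x \in beta) &&
    ((x \notin fingraph.orbit (s * tperm i q)%g i) && orbit_min (s * tperm i q)%g x)]
  = [seq x <- enum 'I_n | (x \in beta :\ i) &&
    ((x \notin fingraph.orbit s q) && orbit_min s x)].
  apply: eq_filter => x; rewrite orbit_insert // !inE negb_or.
  have [->|xi] := eqVneq x i; first by rewrite andbF.
  case xq: (x \in fingraph.orbit s q); first by rewrite andbF.
  by rewrite /orbit_min orbit_insert_other ?xq //=.
apply/eq_in_map => x; rewrite mem_filter !inE => /andP[/andP[/andP[xi _] /andP[xq _]] _].
exact: orbit_insert_other.
Qed.

(** The element [i] starts none of the other cycles. The strict bound keeps the truncated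
    subtraction in the sign exponents exact. *)
Lemma size_other_cycles beta i s :
  i \in beta -> (size (other_cycles beta i s) < #|beta|)%N.
Proof.
move=> ib; rewrite size_map size_filter cardE -[ltnRHS](count_predC (fun x =>
  (x \notin fingraph.orbit s i) && orbit_min s x)) -addn1 leq_add2l -has_count.
by apply/hasP; exists i; rewrite ?mem_enum //= in_orbit.
Qed.

(** If [i] is fixed, its cycle closes with [b i]. Otherwise [i] is followed by some [q]: the entry
    [M i q] joins [z], and deleting [i] shortens the cycle without changing the number of cycles,
    which flips the sign. *)
Lemma cdet_insert_rec M beta i z b : i \in beta ->
  cdet_insert M beta i z b = perm_det (beta :\ i) M * z * b i
    - \sum_(q in beta :\ i) cdet_insert M (beta :\ i) q (z * M i q) b.
Proof.
move=> ib; have cb : #|beta| = #|beta :\ i|.+1 by rewrite (cardsD1 i) ib.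
rewrite [LHS](sum_perm_insert _ ib) (big_setD1 i) //=; congr (_ + _).
  rewrite !mulr_suml; apply: eq_bigr => s sb.
  rewrite tperm1 mulg1 other_cycles_fixed // cb subSS orbit_fixed //.
  by rewrite (out_perm sb) // !inE eqxx.
rewrite -sumrN; apply: eq_bigr => q qb; rewrite -sumrN; apply: eq_bigr => s sb.
have iq : i != q by move: qb; rewrite !inE eq_sym => /andP[].
have si : s i = i by rewrite (out_perm sb) // !inE eqxx.
rewrite other_cycles_insert // orbit_insert // cb.
have [c Ec] := orbit_cons s q; rewrite Ec [chain_prod _ _ (i :: _)]/=.
by rewrite subSn ?size_other_cycles // exprS mulN1r !mulNr !mulrA.
Qed.

Lemma perm_det0 M : perm_det finset.set0 M = 1.
Proof.
rewrite /perm_det (big_pred1 1%g) => [|s].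
  by rewrite /all_cycles enum_set0 big_nil cards0 /= mulr1.
apply/idP/eqP => [s0|->]; last exact: perm_on1.
by apply/permP => x; rewrite perm1 (out_perm s0) ?inE.
Qed.

Lemma enum_min_cons beta i : i \in beta -> (forall x, x \in beta -> (i <= x)%N) ->
  enum beta = i :: enum (beta :\ i).
Proof.
move=> ib imin; pose r (x y : 'I_n) := (x < y)%N.
have rtr : transitive r by move=> y x z; apply: ltn_trans.
have rirr : irreflexive r by move=> x; apply: ltnn.
have rs (A : {set 'I_n}) : sorted r (enum A).
  apply: sorted_filter => //; rewrite -enumT.
  by have := iota_ltn_sorted 0 n; rewrite -val_enum_ord sorted_map.
apply: (irr_sorted_eq rtr rirr) => //= [|x].
  rewrite path_min_sorted //; apply/allP => x; rewrite mem_enum !inE => /andP[xi xb].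
  by rewrite /r ltn_neqAle imin // andbT; apply: contraNneq xi => /val_inj ->.
rewrite inE !mem_enum !inE; have [->|] := eqVneq x i => //=.
Qed.

(** The cycle of the smallest element comes first in both conventions. *)
Lemma perm_det_min M beta i : i \in beta -> (forall x, x \in beta -> (i <= x)%N) ->
  perm_det beta M = cdet beta i M.
Proof.
move=> ib imin; apply: eq_bigr => s sb.
suff -> : all_cycles beta s = cycles_from beta i s by [].
rewrite /all_cycles /cycles_from (enum_min_cons ib imin) /= in_orbit /=.
have -> : orbit_min s i by apply/allP => y yi; rewrite imin // (mem_orbit_on sb ib yi).
congr (_ :: map _ _); apply: eq_in_filter => x; rewrite mem_enum !inE => /andP[xi xb].
have [xo|] //= := boolP (x \in fingraph.orbit s i).
apply/negbTE/allPn; exists i; first by rewrite mem_orbit_sym.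
by rewrite -ltnNge ltn_neqAle imin // andbT; apply: contraNneq xi => /val_inj ->.
Qed.

Lemma replace_col_id M i : replace_col M i (col i M) = M.
Proof. by apply/matrixP => p q; rewrite !mxE; case: eqP => // ->. Qed.

Lemma conjtrE m1 m2 (A : 'M[H]_(m1, m2)) i j : conjtr A i j = qconj (A j i).
Proof. by rewrite !mxE. Qed.

Lemma orbitV s x y : (y \in fingraph.orbit (s^-1)%g x) = (y \in fingraph.orbit s x).
Proof.
rewrite -!fconnect_orbit -(same_fconnect_finv (@perm_inj _ s)); apply: eq_fconnect => z.
by apply: (perm_inj (s := s)); rewrite permKV (f_finv perm_inj).
Qed.

(** Conjugation reverses the product, and the reversed cycle with transposed entries is the cycle of
    the inverse permutation. *)
Lemma cycle_prodV M s x :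
  cycle_prod (conjtr M) (fingraph.orbit (s^-1)%g x) =
  qconj (cycle_prod M (fingraph.orbit s x)).
Proof.
have cpE N (t : {perm 'I_n}) : cycle_prod N (fingraph.orbit t x) =
    \prod_(k <- iota 0 (fingraph.order t x)) N (iter k t x) (iter k.+1 t x).
  rewrite /cycle_prod.
  have -> : zip (fingraph.orbit t x) (rot 1 (fingraph.orbit t x)) =
      [seq (iter k t x, iter k.+1 t x) | k <- iota 0 (fingraph.order t x)].
    apply: (@eq_from_nth _ (x, x)).
      by rewrite size_zip size_rot minnn size_orbit size_map size_iota.
    move=> k; rewrite size_zip size_rot minnn size_orbit => kx.
    rewrite nth_zip ?size_rot // (nth_map 0%N) ?size_iota // nth_iota //.
    rewrite {1}/fingraph.orbit nth_traject //; congr (_, _).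
    have kx1 := kx; rewrite leq_eqVlt in kx1.
    rewrite /rot nth_cat size_drop size_orbit; case/orP: kx1 => [/eqP kx1|kx1].
      rewrite -kx1 subn1 ltnn subnn /fingraph.orbit -kx1 /=.
      by rewrite add0n [RHS](_ : _ = iter k.+1 t x) // kx1 (iter_order perm_inj).
    rewrite ltn_subRL add1n kx1 nth_drop add1n /fingraph.orbit nth_traject //.
  by rewrite big_map.
rewrite !cpE qconj_prod_rev.
have os : fingraph.order (s^-1)%g x = fingraph.order s x.
  by apply: eq_card => y; have := orbitV s x y; rewrite -!fconnect_orbit.
rewrite os; set m := fingraph.order s x.
have smx : iter m s x = x by apply: iter_order perm_inj x.
rewrite -[rev _]map_id.
have -> : rev (iota 0 m) = [seq (m - k.+1)%N | k <- iota 0 m].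
  apply: (@eq_from_nth _ 0%N); first by rewrite size_rev size_map.
  move=> k; rewrite size_rev size_iota => km.
  rewrite nth_rev ?size_iota // (nth_map 0%N) ?size_iota // !nth_iota //.
  by rewrite ltn_subrL (leq_ltn_trans _ km).
rewrite map_id big_map; apply: eq_big_seq => k; rewrite mem_iota add0n => /andP[_ km].
have it l : (l <= m)%N -> iter l (s^-1)%g x = iter (m - l) s x.
  elim: l => [_|l IH lm]; first by rewrite subn0 smx.
  rewrite iterS IH ?(ltnW lm) //; apply: (perm_inj (s := s)).
  by rewrite permKV -iterS -subSn.
by rewrite !it ?(ltnW km) // conjtrE -subSn.
Qed.

(** Conjugation reverses the order of the cycles and each cycle. Summing over inverse permutations
    absorbs the latter, since inverse permutations have the same orbits and hence the same starting
    points. *)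
Lemma qconj_cdet M beta i : qconj (cdet beta i M) = rdet beta i (conjtr M).
Proof.
rewrite /cdet raddf_sum [RHS](reindex_inj invg_inj).
apply: eq_big => [s|s sb].
  by apply/idP/idP => /perm_onV; rewrite ?invgK.
have min_orbitV (x : 'I_n) : all (fun y : 'I_n => x <= y)%N (fingraph.orbit (s^-1)%g x) =
    all (fun y : 'I_n => x <= y)%N (fingraph.orbit s x).
  by apply: eq_all_r => y; rewrite orbitV.
pose e := i :: [seq x <- enum beta | (x \notin fingraph.orbit s i) && orbit_min s x].
have cE (t : {perm 'I_n}) : t = s \/ t = (s^-1)%g ->
    cycles_from beta i t = [seq fingraph.orbit t x | x <- e].
  move=> ts; rewrite /cycles_from /e /=; congr (_ :: map _ _).
  by case: ts => -> //; apply: eq_filter => x; rewrite orbitV min_orbitV.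
cbv beta zeta; move: e cE => e cE; rewrite (cE s) ?(cE (s^-1)%g); [|by right|by left].
rewrite !(size_map _ e).
have -> : (-1) ^+ (#|beta| - size e) = qreal ((-1) ^+ (#|beta| - size e)) :> H.
  by rewrite rmorphXn rmorphN1.
rewrite /= qconjM qconj_real -qrealC.
congr (_ * _); rewrite qconj_prod_rev revK !big_map.
by apply: eq_bigr => x _; rewrite cycle_prodV.
Qed.

End PathExpansion.

(** * Determinants and adjugates of Hermitian quaternion matrices *)

Section HermitianDeterminant.
Variables (R : realType) (n : nat) (M : 'M[quat R]_n).
Local Notation H := (quat R).
Implicit Types (beta gamma B : {set 'I_n}) (i j p q : 'I_n).

(** For Hermitian [M] the real part loses nothing, by [herm_goodP]. *)
Definition pdet beta : R := qre (perm_det beta M).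

Fixpoint padj_fuel m beta i p : H :=
  if m is m'.+1 then
    (if i == p then qreal (pdet (beta :\ i)) else 0)
    - \sum_(q in beta :\ i) M i q * padj_fuel m' (beta :\ i) q p
  else 0.

(* The principal submatrix on [beta] has adjugate [padj beta]: the coefficient of
   [b p] in [cdet beta i] of [M] with column [i] replaced by [b]. *)
Definition padj beta i p : H := padj_fuel #|beta| beta i p.

Lemma padjE beta i p : i \in beta ->
  padj beta i p = (if i == p then qreal (pdet (beta :\ i)) else 0)
    - \sum_(q in beta :\ i) M i q * padj (beta :\ i) q p.
Proof. by move=> ib; rewrite /padj (cardsD1 i) ib. Qed.

Lemma padj_out beta i p : i \in beta -> p \notin beta -> padj beta i p = 0.
Proof.
elim: {beta}#|beta| {-2}beta (leqnn #|beta|) i => [|m IH] beta.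
  by rewrite leqn0 cards_eq0 => /eqP -> i; rewrite inE.
move=> bm i ib pb; rewrite padjE //; case: eqP pb => [<-|_ pb]; first by rewrite ib.
rewrite big1 ?subr0 // => q qb; rewrite IH ?mulr0 //.
  by move: bm; rewrite (cardsD1 i) ib.
by rewrite !inE negb_and pb orbT.
Qed.

Lemma padj_diag beta i : i \in beta -> padj beta i i = qreal (pdet (beta :\ i)).
Proof.
move=> ib; rewrite padjE // eqxx big1 ?subr0 // => q qb.
by rewrite padj_out ?mulr0 // !inE eqxx.
Qed.

Lemma padj_sum beta i (b : 'I_n -> H) : i \in beta ->
  \sum_(p in beta) padj beta i p * b p = qreal (pdet (beta :\ i)) * b i
    - \sum_(q in beta :\ i) M i q * \sum_(p in beta :\ i) padj (beta :\ i) q p * b p.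
Proof.
move=> ib; rewrite (big_setD1 i) //= padj_diag //; congr (_ + _).
under [X in - X]eq_bigr do rewrite mulr_sumr.
rewrite exchange_big -sumrN; apply: eq_bigr => p pb /=.
rewrite padjE // ifN; last by move: pb; rewrite !inE eq_sym => /andP[].
by rewrite sub0r mulNr mulr_suml; congr (- _); apply: eq_bigr => q _; rewrite mulrA.
Qed.

(** Real minors are central, so [z] can be pulled out to the left of each term of the recursion.
    Realness on proper subsets is enough, as [i] is removed first; this lets the lemma serve inside
    the induction on [beta]. *)
Lemma cdet_insert_padj beta i z (b : 'I_n -> H) :
  (forall gamma, gamma \proper beta -> perm_det gamma M = qreal (pdet gamma)) ->
  i \in beta ->
  cdet_insert M beta i z b = z * \sum_(p in beta) padj beta i p * b p.
Proof.
elim: {beta}#|beta| {-2}beta (leqnn #|beta|) i z => [|m IH] beta.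
  by rewrite leqn0 cards_eq0 => /eqP -> i z; rewrite inE.
move=> bm i z realb ib; rewrite cdet_insert_rec // padj_sum //.
have pi : beta :\ i \proper beta by apply: properD1.
rewrite realb // qrealC -mulrA mulrBr; congr (_ - _); rewrite mulr_sumr.
apply: eq_bigr => q qb; rewrite IH ?mulrA //.
  by move: bm; rewrite (cardsD1 i) ib.
by move=> gamma gb; apply: realb; apply: proper_trans pi.
Qed.

(** Bundled so that the induction on [beta] has all three properties at hand on proper subsets. *)
Definition herm_good beta :=
  [/\ perm_det beta M = qreal (pdet beta),
      {in beta &, forall i p, qconj (padj beta i p) = padj beta p i}
    & {in beta &, forall i j, \sum_(p in beta) padj beta i p * M p j =
                              if i == j then qreal (pdet beta) else 0}].

Hypothesis M_herm : hermitian M.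

Lemma herm_entry i j : qconj (M i j) = M j i.
Proof. by rewrite -[in RHS]M_herm conjtrE. Qed.

Section Step.
Variable beta : {set 'I_n}.
Hypothesis IH : forall gamma, gamma \proper beta -> herm_good gamma.

(** Expand at [i] on the left, then, the smaller adjugate being Hermitian, at [p] on the right.
    Conjugation visibly exchanges [i] and [p] in the result. *)
Lemma padj_two_sided i p : i \in beta -> p \in beta -> i != p ->
  padj beta i p = - (qreal (pdet (beta :\ i :\ p)) * M i p)
   + \sum_(q in beta :\ i :\ p) \sum_(t in beta :\ i :\ p)
        M i q * padj (beta :\ i :\ p) q t * M t p.
Proof.
move=> ib pb ip; set gamma := beta :\ i :\ p.
have pi : beta :\ i \proper beta by apply: properD1.
have pb' : p \in beta :\ i by rewrite !inE eq_sym ip.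
have pg : gamma \proper beta by apply: proper_trans pi; apply: properD1.
have [_ hi _] := IH pi; have [_ hg _] := IH pg.
rewrite padjE // (negbTE ip) sub0r (big_setD1 p) //= padj_diag // qrealC opprD.
congr (_ + _); rewrite -sumrN; apply: eq_bigr => q qg.
have /andP[qp qb] : (q != p) && (q \in beta :\ i) by rewrite -in_setD1.
rewrite -hi // padjE // eq_sym (negbTE qp) sub0r raddfN /= raddf_sum mulrN opprK.
rewrite mulr_sumr; apply: eq_bigr => t tg /=.
by rewrite qconjM herm_entry hg // mulrA.
Qed.

Lemma padj_herm : {in beta &, forall i p, qconj (padj beta i p) = padj beta p i}.
Proof.
move=> i p ib pb; have [->|ip] := eqVneq i p; first by rewrite padj_diag // qconj_real.
have ig : beta :\ i :\ p \proper beta.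
  by apply: (sub_proper_trans (subD1set _ _)); apply: properD1.
have [_ hg _] := IH ig.
rewrite !padj_two_sided // 1?eq_sym // raddfD raddfN /= qconjM qconj_real herm_entry.
have -> : beta :\ p :\ i = beta :\ i :\ p by rewrite !setDDl setUC.
rewrite -qrealC; congr (_ + _); rewrite exchange_big raddf_sum; apply: eq_bigr => q qg /=.
rewrite raddf_sum; apply: eq_bigr => t tg /=.
by rewrite !qconjM !herm_entry hg // mulrA.
Qed.

(** In [padj_sum] applied to column [j], induction leaves only the term [q = j], which cancels the
    leading one. *)
Lemma padj_mul_off i j : i \in beta -> j \in beta -> i != j ->
  \sum_(p in beta) padj beta i p * M p j = 0.
Proof.
move=> ib jb ij; have [_ _ hi] := IH (properD1 ib).
have jb' : j \in beta :\ i by rewrite !inE eq_sym ij.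
rewrite padj_sum // (big_setD1 j) //= hi // eqxx -qrealC big1 ?addr0 ?subrr //.
move=> q; rewrite in_setD1 => /andP[qj qb].
by rewrite hi // (negbTE qj) mulr0.
Qed.

(** The diagonal of the adjugate times [M_beta]. What remains is that it is real and constant. *)
Let f i := \sum_(p in beta) padj beta i p * M p i.
Let g i := qre (f i).

(** The recursion subtracts from a real multiple of [M i i] a Hermitian form evaluated at row [i];
    both are fixed by conjugation. *)
Lemma padj_mul_real i : i \in beta -> f i = qreal (g i).
Proof.
move=> ib; apply: qconj_fixed; have [_ hi _] := IH (properD1 ib).
rewrite /f padj_sum // raddfB /= qconjM qconj_real herm_entry -qrealC; congr (_ - _).
under eq_bigr do rewrite mulr_sumr; rewrite [RHS]exchange_big /= raddf_sum.
apply: eq_bigr => p pb /=.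
rewrite raddf_sum; apply: eq_bigr => q qb /=.
by rewrite !qconjM !herm_entry hi // mulrA.
Qed.

Lemma padj_mul i j : i \in beta -> j \in beta ->
  \sum_(p in beta) padj beta i p * M p j = if i == j then qreal (g i) else 0.
Proof.
move=> ib jb; case: eqVneq => [<-|]; last exact: padj_mul_off.
exact: padj_mul_real.
Qed.

(* Computing [M padj M] in two ways. *)
Lemma entry_eq0 i j : i \in beta -> j \in beta -> g i != g j -> M i j = 0.
Proof.
move=> ib jb gij; have : \sum_(q in beta) M i q * \sum_(p in beta) padj beta q p * M p j
    = \sum_(p in beta) (\sum_(q in beta) M i q * padj beta q p) * M p j.
  under eq_bigr do rewrite mulr_sumr; rewrite exchange_big /=.
  by apply: eq_bigr => p _; rewrite mulr_suml; apply: eq_bigr => q _; rewrite mulrA.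
have -> : \sum_(q in beta) M i q * \sum_(p in beta) padj beta q p * M p j =
    qreal (g j) * M i j.
  rewrite (big_setD1 j) //= padj_mul // eqxx -qrealC big1 ?addr0 // => q.
  by rewrite in_setD1 => /andP[qj qb]; rewrite padj_mul // (negbTE qj) mulr0.
(* The product in the other order follows by conjugation, both factors being Hermitian. *)
have mulr_padj p : p \in beta ->
    \sum_(q in beta) M i q * padj beta q p = if p == i then qreal (g p) else 0.
  move=> pb; rewrite -[LHS]qconjK raddf_sum /=.
  have -> : \sum_(q in beta) qconj (M i q * padj beta q p) =
      \sum_(q in beta) padj beta p q * M q i.
    by apply: eq_bigr => q qb; rewrite qconjM herm_entry padj_herm.
  by rewrite padj_mul //; case: eqP => _; rewrite ?qconj_real // raddf0.
rewrite (big_setD1 i) //= mulr_padj // eqxx big1 ?addr0 => [|p]; last first.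
  by rewrite in_setD1 => /andP[pi pb]; rewrite mulr_padj // (negbTE pi) mul0r.
move=> /eqP; rewrite -subr_eq0 -mulrBl -rmorphB /= => /eqP gM.
rewrite -[LHS]mul1r -(rmorph1 (@qreal R)) -(@mulVf _ (g j - g i)); last first.
  by rewrite subr_eq0 eq_sym.
by rewrite rmorphM -mulrA gM mulr0.
Qed.

(** When [M_beta] is block diagonal along [B], the adjugate on the block in [B] is the adjugate of
    that block times the determinant of the other one. *)
Lemma padj_mul_block B i :
  {in beta & beta, forall x y, x \in B -> y \notin B -> M x y = 0} ->
  i \in beta -> i \in B -> beta :&: B \proper beta ->
  f i = qreal (pdet (beta :&: B) * pdet (beta :\: B)).
Proof.
move=> M0 ib iB pB.
have M0' x y : x \in beta -> y \in beta -> x \notin B -> y \in B -> M x y = 0.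
  by move=> xb yb xB yB; rewrite -herm_entry M0 // raddf0.
(* Stated for all subsets, because the induction below also needs it for [gamma :\ x]. *)
have block gamma : gamma \subset beta -> {in gamma :&: B &, forall x p,
    padj gamma x p = padj (gamma :&: B) x p * qreal (pdet (gamma :\: B))} ->
    {in gamma :&: B, forall x, \sum_(p in gamma) padj gamma x p * M p x =
      qreal (pdet (gamma :&: B) * pdet (gamma :\: B))}.
  move=> gb padjM x; rewrite inE => /andP[xg xB].
  have pgB : gamma :&: B \proper beta.
    by apply: sub_proper_trans pB; apply: setSI.
  have [_ _ hB] := IH pgB.
  have xgB : x \in gamma :&: B by rewrite inE xg.
  have := hB _ _ xgB xgB; rewrite eqxx => hx.
  rewrite rmorphM /= qrealC -hx mulr_sumr (big_setID B) /= [X in _ + X]big1 ?addr0.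
    by apply: eq_bigr => p pgB'; rewrite padjM // -qrealC mulrA.
  move=> p; rewrite inE => /andP[pB' pg].
  by rewrite M0' ?mulr0 // (subsetP gb).
suff padjM gamma : gamma \subset beta -> {in gamma :&: B &, forall x p,
    padj gamma x p = padj (gamma :&: B) x p * qreal (pdet (gamma :\: B))}.
  by apply: (block beta) => //; [apply: padjM | rewrite inE ib].
elim: {gamma}#|gamma| {-2}gamma (leqnn #|gamma|) => [|m IHm] gamma.
  by rewrite leqn0 cards_eq0 => /eqP -> _ x p; rewrite !inE.
move=> gm gb x p xgB pgB; have /setIP[xg xB] := xgB.
have gm' : (#|gamma :\ x| <= m)%N by move: gm; rewrite (cardsD1 x) xg.
have gb' : gamma :\ x \subset beta by apply: subset_trans gb; apply: subD1set.
have pg' : gamma :\ x \proper beta by apply: proper_sub_trans gb; apply: properD1.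
have EI : (gamma :\ x) :&: B = (gamma :&: B) :\ x by rewrite setIDAC.
have ED : (gamma :\ x) :\: B = gamma :\: B.
  by apply/setP => y; rewrite !inE; case: eqVneq => [->|] //=; rewrite xB.
(* The determinant is read off as a diagonal entry at an index of [B]; if none is left, that block
   is empty and has determinant 1. *)
have detM : pdet (gamma :\ x) = pdet ((gamma :&: B) :\ x) * pdet (gamma :\: B).
  have [B0|[y yB]] := set_0Vmem ((gamma :\ x) :&: B).
    rewrite -EI -ED B0 [X in X * _](_ : _ = 1) ?mul1r; last by rewrite /pdet perm_det0.
    congr pdet.
    apply/setP => y; have := in_set0 y; rewrite -B0 !inE.
    by case: (y \in B); rewrite //= andbT.
  have yg : y \in gamma :\ x by move: yB; rewrite inE => /andP[].
  have [_ _ hg] := IH pg'; have := hg y y yg yg; rewrite eqxx.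
  rewrite (block _ gb') // ?EI ?ED; first by move=> /qreal_inj ->.
  by rewrite -ED -EI; apply: IHm.
rewrite padjE // [in RHS]padjE // mulrBl detM; congr (_ - _).
  by case: eqP => _; rewrite ?mul0r // rmorphM.
rewrite mulr_suml (big_setID B) /= EI [X in _ + X]big1 ?addr0; last first.
  move=> y; rewrite inE => /andP[yB yg]; rewrite M0 ?mul0r // ?(subsetP gb) //.
  by move: yg; rewrite inE => /andP[].
apply: eq_bigr => y yB; have [->|px] := eqVneq p x.
  rewrite !padj_out ?mulr0 ?mul0r // ?inE ?eqxx //.
  by move: yB; rewrite !inE => /andP[-> /andP[]].
rewrite IHm // ?EI ?ED ?mulrA //. by rewrite in_setD1 px.
Qed.

(* If [g i <> g j], then [M_beta] is block diagonal along a level set of [g], and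
   both [g i] and [g j] are the product of the determinants of the two blocks. *)
Lemma padj_mul_const i j : i \in beta -> j \in beta -> g i = g j.
Proof.
move=> ib jb; apply/eqP/negPn/negP => gij.
pose B := [set x | g x == g i].
have iB : i \in B by rewrite inE.
have jB : j \notin B by rewrite inE eq_sym.
have M0 : {in beta & beta, forall x y, x \in B -> y \notin B -> M x y = 0}.
  by move=> x y xb yb; rewrite !inE => /eqP gx gy; apply: entry_eq0; rewrite // gx eq_sym.
have M0' : {in beta & beta, forall x y, x \in ~: B -> y \notin ~: B -> M x y = 0}.
  move=> x y xb yb; rewrite !inE negbK => gx /eqP gy.
  by apply: entry_eq0; rewrite // gy.
have pB : beta :&: B \proper beta.
  by apply/properP; split; [apply: subsetIl | exists j; rewrite // inE (negbTE jB) andbF].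
have pB' : beta :&: ~: B \proper beta.
  by apply/properP; split; [apply: subsetIl | exists i; rewrite // !inE eqxx andbF].
have := padj_mul_block M0 ib iB pB; have := padj_mul_block M0' jb _ pB'.
rewrite inE jB padj_mul_real // padj_mul_real // setDE setCK -setDE => /(_ isT).
rewrite mulrC => gj gi; move: gij; rewrite -(inj_eq (@qreal_inj R)) gi gj.
by rewrite setDE eqxx.
Qed.

Lemma herm_good_step : herm_good beta.
Proof.
have [->|[j jb]] := set_0Vmem beta.
  by split; [rewrite /pdet perm_det0 | move=> i p; rewrite inE ..].
(* At the smallest index [perm_det] is a column determinant, hence equals [g i]; constancy of [g]
   then reaches every other index. *)
have [i ib imin] : exists2 i, i \in beta & forall x, x \in beta -> (i <= x)%N.
  by case: (arg_minnP (fun x : 'I_n => x : nat) jb) => i ib imin; exists i.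
have detE : perm_det beta M = qreal (g i).
  rewrite (perm_det_min _ ib imin) -{1}(replace_col_id M i) cdet_replace_col.
  rewrite cdet_insert_padj // => [|gamma /IH[]//].
  rewrite mul1r -padj_mul_real //; apply: eq_bigr => p _; by rewrite mxE.
have gE : g i = pdet beta by rewrite /pdet detE.
split; first by rewrite detE gE.
  exact: padj_herm.
by move=> x y xb yb; rewrite padj_mul // -gE (padj_mul_const xb ib).
Qed.

End Step.

Lemma herm_goodP beta : herm_good beta.
Proof.
elim: {beta}#|beta| {-2}beta (leqnn #|beta|) => [|m IHm] beta bm;
  apply: herm_good_step => gamma gb.
  by move: (leq_trans (proper_card gb) bm); rewrite ltn0.
by apply: IHm; rewrite -ltnS (leq_trans (proper_card gb)).
Qed.

Lemma cdet_padj beta i (b : 'cV[H]_n) : i \in beta ->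
  cdet beta i (replace_col M i b) = \sum_(p in beta) padj beta i p * b p 0.
Proof.
move=> ib; rewrite cdet_replace_col cdet_insert_padj // ?mul1r // => gamma _.
by have [] := herm_goodP gamma.
Qed.

(** Column determinants come from the adjugate, row determinants by conjugation. An element of
    [beta] is what makes the value chosen by [xget] unique. *)
Lemma hdetE beta : beta != finset.set0 -> hdet beta M = pdet beta.
Proof.
case/set0Pn => j jb; have [_ _ hb] := herm_goodP beta.
have cE i : i \in beta -> cdet beta i M = qreal (pdet beta).
  move=> ib; rewrite -{1}(replace_col_id M i) cdet_padj //.
  by under eq_bigr do rewrite mxE; rewrite hb // eqxx.
have rE i : i \in beta -> rdet beta i M = qreal (pdet beta).
  by move=> ib; rewrite -[in LHS]M_herm -qconj_cdet cE // qconj_real.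
rewrite /hdet; case: xgetP => [d _ /(_ j jb)[_]|/(_ (pdet beta))].
  by rewrite cE // => /qreal_inj.
by case=> i ib; rewrite rE // cE.
Qed.

Lemma padj_rec_right beta i p : i \in beta -> p \in beta -> i != p ->
  padj beta i p = - \sum_(q in beta :\ p) padj (beta :\ p) i q * M q p.
Proof.
move=> ib pb ip; have [_ hb _] := herm_goodP beta.
have [_ hp _] := herm_goodP (beta :\ p).
have ib' : i \in beta :\ p by rewrite !inE ip.
rewrite -hb // padjE // eq_sym (negbTE ip) sub0r raddfN /= raddf_sum; congr (- _).
by apply: eq_bigr => q qb /=; rewrite qconjM herm_entry hp.
Qed.

End HermitianDeterminant.

(** * Sums of principal adjugates *)

Section HermitianMatrices.
Variables (R : realType) (n : nat).
Local Notation H := (quat R).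
Implicit Types (A B M X Y Q : 'M[H]_n) (a : R).

Local Notation rscalar a := ((qreal a)%:M : 'M[H]_n).

Lemma conjtrB A B : conjtr (A - B) = conjtr A - conjtr B.
Proof. by apply/matrixP => i j; rewrite !mxE raddfB. Qed.

Lemma conjtrM A B : conjtr (A * B) = conjtr B * conjtr A.
Proof.
apply/matrixP => i j; rewrite conjtrE !mxE raddf_sum; apply: eq_bigr => p _ /=.
by rewrite qconjM !conjtrE.
Qed.

Lemma conjtr_rscalar a : conjtr (rscalar a) = rscalar a.
Proof.
apply/matrixP => i j; rewrite conjtrE !mxE eq_sym.
by case: eqP => _; rewrite ?mulr1n ?mulr0n ?qconj_real ?raddf0.
Qed.

Lemma comm_rscalar A a : GRing.comm A (rscalar a).
Proof.
rewrite /GRing.comm -!mulmxE mul_scalar_mx.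
apply/matrixP => i j; rewrite !mxE (bigD1 j) //= big1.
  by rewrite mxE eqxx mulr1n addr0 qrealC.
by move=> p pj; rewrite mxE (negbTE pj) mulr0n mulr0.
Qed.

Lemma rscalar0 : rscalar 0 = 0.
Proof. by apply/matrixP => i j; rewrite !mxE mul0rn. Qed.

Lemma rscalarM a b : rscalar (a * b) = rscalar a * rscalar b.
Proof. by rewrite -mulmxE -scalar_mxM -rmorphM. Qed.

Lemma hermitianX A m : hermitian A -> hermitian (A ^+ m).
Proof.
move=> hA; elim: m => [|m IH]; first exact: (conjtr_rscalar 1).
by rewrite /hermitian exprS conjtrM IH hA -exprSr exprS.
Qed.

(** The diagonal entries of [Y * Y] are sums of squared norms of entries of [Y]. *)
Lemma hermitian_sqr_eq0 Y : hermitian Y -> Y * Y = 0 -> Y = 0.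
Proof.
move=> hY YY; apply/matrixP => i j; rewrite mxE; apply/eqP; rewrite -qnorm2_eq0.
have := congr1 (fun Z : 'M[H]_n => qre (Z i i)) YY; rewrite !mxE raddf_sum /= => /eqP.
rewrite psumr_eq0 => [/allP/(_ j)|p _].
  rewrite mem_index_enum => /(_ isT) /= /eqP <-; apply/eqP.
  by rewrite -[in Y j i]hY conjtrE /qnorm2 /=; ring.
rewrite -[in Y p i]hY conjtrE /=.
have -> : forall x : H, qre x * qre x - qi x * - qi x - qj x * - qj x - qk x * - qk x =
   qre x ^+ 2 + qi x ^+ 2 + qj x ^+ 2 + qk x ^+ 2 by move=> x; ring.
by rewrite !addr_ge0 ?sqr_ge0.
Qed.

(** Raise the exponent to a power of two, then halve it repeatedly: each [Q * A ^+ (2 ^ t)] is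
    Hermitian with square zero. *)
Lemma hermitian_mul_expr_eq0 Q A m : hermitian Q -> hermitian A -> GRing.comm Q A ->
  Q * A ^+ m = 0 -> Q * A = 0.
Proof.
move=> hQ hA QA Qm.
suff all_t t : Q * A ^+ (2 ^ t) = 0 -> Q * A = 0.
  apply: (all_t m); rewrite -(subnK (ltnW (ltn_expl m (ltnSn 1)))) addnC.
  by rewrite exprD mulrA Qm mul0r.
elim: t => [|t IH]; first by rewrite expr1.
move=> QA0; apply: IH; set B := A ^+ (2 ^ t).
have QB : GRing.comm Q B by apply: commrX.
apply: hermitian_sqr_eq0.
  by rewrite /hermitian conjtrM (hermitianX _ hA) hQ -QB.
rewrite mulrA -(mulrA Q B Q) -QB mulrA -(mulrA _ B B).
by rewrite /B -exprD addnn -mul2n -expnS -mulrA QA0 mulr0.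
Qed.

(** * Real traces and the rank *)

Definition retr A : R := \sum_i qre (A i i).

Lemma retrB A B : retr (A - B) = retr A - retr B.
Proof. by rewrite /retr -sumrB; apply: eq_bigr => i _; rewrite !mxE. Qed.

Lemma retr_mulC A B : retr (A * B) = retr (B * A).
Proof.
rewrite /retr; under eq_bigr do rewrite mxE raddf_sum.
rewrite exchange_big; apply: eq_bigr => p _ /=; rewrite mxE raddf_sum.
by apply: eq_bigr => i _; apply: qre_mulC.
Qed.

Lemma retr_rscalarM a A : retr (rscalar a * A) = a * retr A.
Proof.
rewrite /retr mulr_sumr; apply: eq_bigr => i _.
by rewrite -mulmxE mul_scalar_mx mxE /=; ring.
Qed.

Lemma retr1 : retr 1 = n%:R.
Proof.
rewrite /retr (eq_bigr (fun=> 1)) => [|i _]; last by rewrite mxE eqxx.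
by rewrite sumr_const card_ord.
Qed.

Lemma retr_rscalar a : retr (rscalar a) = n%:R * a.
Proof. by rewrite -[rscalar a]mulr1 retr_rscalarM retr1 mulrC. Qed.

Lemma qrank_attained A :
  exists2 S : {set 'I_n}, right_indep_cols A S & #|S| = qrank A.
Proof.
have S0 : `[< right_indep_cols A finset.set0 >].
  apply/asboolP => c c0 _; apply/matrixP => i j; rewrite ord1 mxE c0 ?inE //.
pose P := [pred S : {set 'I_n} | `[< right_indep_cols A S >]].
have P0 : (0 < #|P|)%N by apply/card_gt0P; exists finset.set0.
have [S /asboolP hS ES] := eq_bigmax_cond (fun S : {set 'I_n} => #|S|) P0.
by exists S.
Qed.

Lemma qrank_max A (S : {set 'I_n}) : right_indep_cols A S -> (#|S| <= qrank A)%N.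
Proof.
by move=> hS; rewrite /qrank (bigD1 S) ?leq_maxl //; apply/asboolP.
Qed.

(** By maximality, adding [j] to [S] creates a relation with nonzero coefficient at [j], which is
    solved for column [j]. The last clause gives the matrix [T] of [retr_regular] unit diagonal
    entries on [S]. *)
Lemma max_indep_spans A (S : {set 'I_n}) j :
  right_indep_cols A S -> #|S| = qrank A ->
  exists c : 'cV[H]_n, [/\ forall i, i \notin S -> c i 0 = 0, A *m c = col j A
     & j \in S -> c = delta_mx j 0].
Proof.
move=> hS ES; have colE : A *m (delta_mx j 0 : 'cV_n) = col j A by rewrite colE.
have [jS|jS] := boolP (j \in S).
  exists (delta_mx j 0); split=> // i iS; rewrite mxE andbT.
  by case: eqP iS => // ->; rewrite jS.
have : ~ right_indep_cols A (j |: S).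
  by move=> /qrank_max; rewrite cardsU1 jS -ES ltnn.
move=> /existsNP[c] /not_implyP[c0] /not_implyP[Ac cN0].
have cj : c j 0 != 0.
  apply/eqP => cj; apply: cN0; apply: hS => // i iS.
  by have [->//|ij] := eqVneq i j; apply: c0; rewrite !inE negb_or ij.
exists (delta_mx j 0 - c *m (c j 0)^-1%:M);
  split; [|by rewrite mulmxBr colE mulmxA Ac mul0mx subr0|by []].
move=> i iS; rewrite !mxE big_ord1 andbT mxE eqxx mulr1n.
have [->|ij] := eqVneq i j; first by rewrite divrr ?subrr.
by rewrite (c0 i) ?mul0r ?subrr // !inE negb_or ij.
Qed.

(** Write the columns of [A] in a maximal independent set [S] of them: [A = A * T], with the rows of
    [T] supported on [S]. Independence gives [T * Y * A = T], so by cyclicity the trace is that of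
    [T], namely [#|S|]. *)
Lemma retr_regular A Y : A * Y * A = A -> retr (A * Y) = (qrank A)%:R.
Proof.
move=> AYA; have [S hS ES] := qrank_attained A.
have [c hc] := choice (fun j => max_indep_spans j hS ES).
pose T : 'M[H]_n := \matrix_(i, j) c j i 0.
have colT j : col j T = c j by apply/matrixP => i k; rewrite !mxE (ord1 k).
have TS i j : i \notin S -> T i j = 0 by move=> iS; rewrite mxE; case: (hc j) => ->.
have AT : A * T = A.
  apply/matrixP => i j; have [_ /matrixP/(_ i 0) + _] := hc j.
  by rewrite [RHS]mxE => <-; rewrite -colT !mxE; apply: eq_bigr => p _; rewrite !mxE.
have TYA : T * Y * A = T.
  apply/eqP; rewrite -subr_eq0; apply/eqP/matrixP => i j.
  have /matrixP/(_ i 0) : col j (T * Y * A - T) = 0.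
    apply: hS => [p pS|].
      rewrite mxE mxE [X in _ + X]mxE TS // subr0 -mulrA mxE big1 // => q _.
      by rewrite TS ?mul0r.
    by rewrite colE mulmxA mulmxE mulrBr !mulrA AT AYA subrr mul0mx.
  by rewrite !mxE.
rewrite -{1}AT -mulrA retr_mulC TYA /retr -ES -sum1_card natr_sum (big_mkcond (mem S)) /=.
apply: eq_bigr => i _; case: ifPn => iS; last by rewrite TS.
by rewrite mxE; case: (hc i) => _ _ ->//; rewrite mxE !eqxx.
Qed.

Lemma full_rank_inj A (c : 'cV[H]_n) : qrank A = n -> A *m c = 0 -> c = 0.
Proof.
move=> rA; have [S hS ES] := qrank_attained A.
have ST : S = [set: 'I_n] by apply/eqP; rewrite eqEcard finset.subsetT cardsT card_ord ES rA /=.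
by apply: hS => i; rewrite ST inE.
Qed.

Lemma qrank1 : qrank (1 : 'M[H]_n) = n.
Proof.
apply/eqP; rewrite eqn_leq; apply/andP; split.
  by have [S _ <-] := qrank_attained 1; rewrite -[leqRHS](card_ord n) max_card.
rewrite -[leqLHS](card_ord n) -cardsT; apply: qrank_max => c _.
by rewrite mul1mx.
Qed.

End HermitianMatrices.

(** * The recursion linking sums of adjugates and of principal minors *)

Section AdjugateSums.
Variables (R : realType) (n : nat) (M : 'M[quat R]_n).
Local Notation H := (quat R).
Local Notation rscalar a := ((qreal a)%:M : 'M[H]_n).

Definition pdet_sum s : R := \sum_(beta : {set 'I_n} | #|beta| == s) pdet M beta.

(** Adjugates on sets of order [s] have degree [s - 1] in [M], so index [s.+1] here goes with
    [pdet_sum s]. *)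
Definition padj_sum_mx s : 'M[H]_n :=
  \matrix_(i, p) \sum_(beta : {set 'I_n} | (#|beta| == s) && (i \in beta))
    padj M beta i p.

Lemma sum_setD1 (V : nmodType) s q (F : {set 'I_n} -> V) (P : pred {set 'I_n}) :
  \sum_(beta : {set 'I_n} | (#|beta| == s.+1) && (q \in beta) && P (beta :\ q)) F (beta :\ q) =
  \sum_(beta : {set 'I_n} | (#|beta| == s) && (q \notin beta) && P beta) F beta.
Proof.
rewrite (reindex_onto (fun b : {set 'I_n} => q |: b) (fun b => b :\ q)) /=; last first.
  by move=> b /andP[/andP[_ qb] _]; rewrite setD1K.
apply: eq_big => [b|b /andP[_ /eqP ->//]].
have [qb|qb] := boolP (q \in b).
  rewrite andbF; apply/negbTE/negP => /andP[_ /eqP E].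
  by move: qb; rewrite -E !inE eqxx.
by rewrite setU1K // eqxx setU11 !andbT cardsU1 qb.
Qed.

Lemma pdet_sum0 : pdet_sum 0 = 1.
Proof.
rewrite /pdet_sum (big_pred1 finset.set0) => [|b]; last by rewrite cards_eq0.
by rewrite /pdet perm_det0.
Qed.

Lemma pdet_sum_gt s : (n < s)%N -> pdet_sum s = 0.
Proof.
move=> ns; rewrite /pdet_sum big_pred0 // => b; apply/eqP => bs.
by have := max_card (mem b); rewrite bs card_ord leqNgt ns.
Qed.

Lemma padj_sum_mx_gt s : (n < s)%N -> padj_sum_mx s = 0.
Proof.
move=> ns; apply/matrixP => i j; rewrite !mxE big_pred0 // => b.
apply/negbTE; rewrite negb_and; apply/orP; left; apply/eqP => bs.
by have := max_card (mem b); rewrite bs card_ord leqNgt ns.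
Qed.

Lemma padj_sum_mx_mulE s i (m : nat) (B : 'M[H]_(n, m)) j :
  (padj_sum_mx s *m B) i j =
  \sum_(beta : {set 'I_n} | (#|beta| == s) && (i \in beta))
     \sum_(p in beta) padj M beta i p * B p j.
Proof.
rewrite mxE; under eq_bigr do rewrite mxE mulr_suml.
rewrite exchange_big; apply: eq_bigr => b /andP[_ ib] /=.
rewrite [LHS](bigID (mem b)) /= [X in _ + X]big1 ?addr0 // => p pb.
by rewrite padj_out ?mul0r.
Qed.

Hypothesis M_herm : hermitian M.

Lemma padj_sum_mx_mul_diag s i : (padj_sum_mx s * M) i i =
  qreal (\sum_(beta : {set 'I_n} | (#|beta| == s) && (i \in beta)) pdet M beta).
Proof.
rewrite padj_sum_mx_mulE rmorph_sum; apply: eq_bigr => b /andP[_ ib].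
by have [_ _ ->//] := herm_goodP M_herm b; rewrite eqxx.
Qed.

(** On the diagonal, minors avoiding [i] are all minors less those containing [i]. Off it,
    [padj_rec_right] removes [q] from each set; the sets containing [q] add nothing to the product,
    since there adjugate times [M] is diagonal. *)
Lemma padj_sum_mxS s : padj_sum_mx s.+1 = rscalar (pdet_sum s) - padj_sum_mx s * M.
Proof.
apply/matrixP => i q; rewrite [RHS]mxE [X in _ = _ + X]mxE [X in _ = X + _]mxE.
have [<-|iq] := eqVneq i q.
  rewrite padj_sum_mx_mul_diag mulr1n -rmorphB /= /pdet_sum
    (bigID (fun b : {set 'I_n} => i \in b)) /=.
  rewrite addrC addrK mxE rmorph_sum.
  have := @sum_setD1 H s i (fun b => qreal (pdet M b)) predT.
  under [LHS]eq_bigl do rewrite andbT; under [RHS]eq_bigl do rewrite andbT.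
  by move=> <-; apply: eq_bigr => b /andP[_ ib]; rewrite padj_diag.
rewrite mulr0n sub0r padj_sum_mx_mulE mxE.
rewrite (bigID (fun b : {set 'I_n} => q \in b)) /= addrC big1 ?add0r; last first.
  by move=> b /andP[/andP[_ ib] qb]; rewrite padj_out.
rewrite [in RHS](bigID (fun b : {set 'I_n} => q \in b)) /=.
rewrite [X in _ = - (X + _)]big1 ?add0r; last first.
  move=> b /andP[/andP[_ ib] qb]; have [_ _ hb] := herm_goodP M_herm b.
  by rewrite hb // (negbTE iq).
rewrite -sumrN.
have := @sum_setD1 H s q (fun b => - \sum_(p in b) padj M b i p * M p q)
  (fun b => i \in b).
under [LHS]eq_bigl do rewrite in_setD1 iq /= andbAC.
under [RHS]eq_bigl do rewrite andbAC.
move=> <-; apply: eq_bigr => b /andP[/andP[_ ib] qb].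
exact: padj_rec_right.
Qed.

Lemma padj_sum_mx0 : padj_sum_mx 0 = 0.
Proof.
apply/matrixP => i j; rewrite !mxE big_pred0 // => b; rewrite cards_eq0.
by apply/negbTE/negP => /andP[/eqP ->]; rewrite inE.
Qed.

Lemma padj_sum_mx_comm s A : GRing.comm A M -> GRing.comm A (padj_sum_mx s).
Proof.
move=> AM; elim: s => [|s IH]; first by rewrite padj_sum_mx0; apply: commr0.
by rewrite padj_sum_mxS; apply: commrB; [apply: comm_rscalar | apply: commrM].
Qed.

Lemma padj_sum_mx_herm s : hermitian (padj_sum_mx s).
Proof.
elim: s => [|s IH].
  by rewrite padj_sum_mx0; apply/matrixP => i j; rewrite conjtrE !mxE raddf0.
rewrite padj_sum_mxS /hermitian conjtrB conjtr_rscalar conjtrM IH M_herm.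
by rewrite -(padj_sum_mx_comm s (commr_refl M)).
Qed.

Lemma retr_padj_sum_mx s : retr (padj_sum_mx s.+1) = (n%:R - s%:R) * pdet_sum s.
Proof.
rewrite padj_sum_mxS retrB retr_rscalar mulrBl; congr (_ - _).
rewrite /retr; under eq_bigr do rewrite padj_sum_mx_mul_diag /=.
rewrite /pdet_sum mulr_sumr.
under eq_bigr do rewrite big_mkcondr /=.
rewrite exchange_big; apply: eq_bigr => b /eqP bs /=.
(* Each set of order [s] is counted once for each of its elements. *)
by rewrite -big_mkcond sumr_const bs mulr_natl.
Qed.

Lemma last_pdet_sum :
  exists r, [/\ (r <= n)%N, pdet_sum r != 0 & forall s, (r < s)%N -> pdet_sum s = 0].
Proof.
have ex0 : exists s, pdet_sum s != 0 by exists 0%N; rewrite pdet_sum0 oner_eq0.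
have ub s : pdet_sum s != 0 -> (s <= n)%N.
  by apply: contraNT; rewrite -ltnNge => /pdet_sum_gt ->.
case: (ex_maxnP ex0 ub) => r dr rmax; exists r; split=> //; first exact: ub.
by move=> s; apply: contraTeq => /rmax; rewrite -leqNgt.
Qed.

(** Beyond [r] the recursion loses its scalar term, so up to sign the product is the adjugate sum of
    order [n.+1], which is empty. *)
Lemma padj_sum_mx_nil r : (r <= n)%N -> (forall s, (r < s)%N -> pdet_sum s = 0) ->
  padj_sum_mx r.+1 * M ^+ (n - r) = 0.
Proof.
move=> rn d0.
suff desc m t :
    padj_sum_mx (r.+1 + m)%N * M ^+ t = 0 -> padj_sum_mx r.+1 * M ^+ (m + t)%N = 0.
  rewrite -[X in M ^+ X]addn0; apply: (desc (n - r)%N 0%N).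
  by rewrite addSn subnKC // padj_sum_mx_gt ?mul0r.
elim: m t => [|m IH] t; first by rewrite addn0.
rewrite addnS padj_sum_mxS d0 ?addSn ?ltnS ?leq_addr // rscalar0 sub0r mulNr -mulrA -exprS.
by move=> /eqP; rewrite oppr_eq0 => /eqP; rewrite -addSn => /IH; rewrite addnS.
Qed.

End AdjugateSums.

(** * The Drazin inverse *)

Section HermitianDrazin.
Variables (R : realType) (n k : nat) (A : 'M[quat R]_n).
Local Notation H := (quat R).
Local Notation rscalar a := ((qreal a)%:M : 'M[H]_n).
Hypothesis A_herm : hermitian A.

Let M := A ^+ k.+1.
Let L := padj_sum_mx M.
Let d := pdet_sum M.

Let M_herm : hermitian M. Proof. exact: hermitianX. Qed.

Let A_comm_L s : GRing.comm A (L s).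
Proof. by apply: padj_sum_mx_comm => //; apply: commrX. Qed.

Lemma padj_sum_mx_annihilates :
  exists2 r, d r != 0 & L r.+1 * A = 0.
Proof.
have [r [rn dr d0]] := last_pdet_sum M; exists r => //.
apply: (@hermitian_mul_expr_eq0 _ _ _ _ (k.+1 * (n - r))) => //.
- exact: padj_sum_mx_herm.
- exact/commr_sym.
by rewrite exprM; apply: padj_sum_mx_nil.
Qed.

Lemma rscalar_annihilator s : L s.+1 * A = 0 -> rscalar (d s) * A = L s * M * A.
Proof.
by rewrite /L padj_sum_mxS // mulrBl => /eqP; rewrite subr_eq0 => /eqP.
Qed.

Lemma herm_drazin_exists : qrank (A ^+ k.+1) = qrank (A ^+ k) ->
  exists X, [/\ A ^+ k.+1 *m X = A ^+ k, X *m A *m X = X & A *m X = X *m A].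
Proof.
move=> rA; have [r dr LA] := padj_sum_mx_annihilates.
(* Dividing [rscalar_annihilator] by [d r] shows that [Y] is an inner inverse of [A]. As it commutes
   with [A], [Y * A * Y] is the group inverse. *)
pose Y := rscalar (d r)^-1 * L r * A ^+ k.
have AY : GRing.comm A Y.
  by apply: commrM; [apply: commrM; [apply: comm_rscalar|]|apply: commrX].
have AYA : A * Y * A = A.
  rewrite AY /Y -(mulrA _ (A ^+ k) A) -exprSr -/M -(mulrA _ (L r) M).
  by rewrite -(mulrA _ (L r * M)) -rscalar_annihilator // mulrA -rscalarM mulVf // mul1r.
clearbody Y; exists (Y * A * Y); rewrite !mulmxE; split.
- have AX : A * A * (Y * A * Y) = A.
    have -> : A * A * (Y * A * Y) = A * (A * Y * A) * Y by rewrite !mulrA.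
    by rewrite AYA -mulrA AY mulrA AYA.
  (* For [k = 0] the rank hypothesis says that [A] has full rank, so a factor [A] can be
     cancelled. *)
  case: k rA => [|k'] rA; last by rewrite -(addn2 k') exprD expr2 -mulrA AX exprSr.
  rewrite expr0 expr1; apply/eqP; rewrite -subr_eq0; apply/eqP/matrixP => i j.
  have /matrixP/(_ i 0) : col j (A * (Y * A * Y) - 1) = 0.
    apply: (@full_rank_inj _ _ A); first by rewrite expr1 expr0 qrank1 in rA.
    by rewrite colE mulmxA mulmxE mulrBr (mulrA A A) AX mulr1 subrr mul0mx.
  by rewrite !mxE.
- have -> : Y * A * Y * A * (Y * A * Y) = Y * (A * Y * A) * Y * A * Y by rewrite !mulrA.
  rewrite AYA; have -> : Y * A * Y * A * Y = Y * (A * Y * A) * Y by rewrite !mulrA.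
  by rewrite AYA.
- have -> : A * (Y * A * Y) = A * Y * A * Y by rewrite !mulrA.
  have -> : Y * A * Y * A = Y * (A * Y * A) by rewrite !mulrA.
  by rewrite AYA.
Qed.

Section Drazin.
Variable X : 'M[H]_n.
Hypotheses (AkX : A ^+ k.+1 *m X = A ^+ k) (XAX : X *m A *m X = X)
  (AX : A *m X = X *m A).

Lemma expr_mul_drazin m : A ^+ (k + m) * X ^+ m = A ^+ k.
Proof.
elim: m => [|m IH]; first by rewrite addn0 mulr1.
have XA : A ^+ m * X = X * A ^+ m.
  by apply/commr_sym/commrX; rewrite /GRing.comm -!mulmxE AX.
rewrite addnS -addSn exprD -mulrA [X ^+ m.+1]exprS (mulrA (A ^+ m)) XA.
by rewrite -mulrA mulrA -mulmxE AkX mulmxE mulrA -exprD IH.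
Qed.

(** [X ^+ k] is an inner inverse of [A ^+ k]. *)
Lemma retr_expr_mul_drazin : retr (A ^+ k * X ^+ k) = (qrank (A ^+ k))%:R.
Proof.
apply: retr_regular; rewrite -[RHS](expr_mul_drazin k) exprD -!mulrA.
have -> // : X ^+ k * A ^+ k = A ^+ k * X ^+ k.
by apply/commr_sym/commrX/commr_sym/commrX; rewrite /GRing.comm -!mulmxE AX.
Qed.

Lemma rank_of_annihilator r : d r != 0 -> L r.+1 * A = 0 -> qrank (A ^+ k) = r.
Proof.
move=> dr LA; pose P := A ^+ k * X ^+ k.
have LP : L r.+1 * P = 0.
  rewrite /P -(expr_mul_drazin 1) addn1 exprS -mulrA.
  by rewrite -!mulrA [L _ * _]mulrA LA mul0r.
have MP : M * P = M.
  by rewrite /P /M exprS -!mulrA [A ^+ k * _]mulrA -exprD expr_mul_drazin.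
have := retr_padj_sum_mx M_herm r.
(* [L r.+1] is unchanged by the factor [1 - P], which kills the term [L r * M] of the recursion. *)
have -> : padj_sum_mx M r.+1 = rscalar (d r) * (1 - P).
  rewrite -[LHS]subr0 -LP -[X in X - _]mulr1 -mulrBr /L padj_sum_mxS // mulrBl.
  by rewrite -[_ * M * _]mulrA [M * _]mulrBr mulr1 MP subrr mulr0 subr0.
rewrite retr_rscalarM retrB retr1 retr_expr_mul_drazin mulrC => /(mulIf dr).
by move=> /addrI /oppr_inj /eqP; rewrite eqr_nat => /eqP.
Qed.

Lemma drazin_eq r : qrank (A ^+ k) = r ->
  d r != 0 /\ rscalar (d r) * X = L r * A ^+ k.
Proof.
move=> rA; have [s ds LA] := padj_sum_mx_annihilates.
have Es : s = r by rewrite -rA; apply/esym/rank_of_annihilator.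
rewrite {}Es in ds LA; split=> //.
have XE : X = A * X * X by rewrite -[LHS]XAX -AX !mulmxE.
rewrite {1}XE mulrA mulrA rscalar_annihilator // -!mulrA; congr (_ * _).
by rewrite -(expr_mul_drazin 2) addn2 expr2 /M mulrA -exprSr.
Qed.

(** [X] is a real multiple of a product of commuting Hermitian matrices. *)
Lemma drazin_herm : hermitian X.
Proof.
have [dr E] := drazin_eq erefl.
have -> : X = rscalar (d (qrank (A ^+ k)))^-1 * (L (qrank (A ^+ k)) * A ^+ k).
  by rewrite -E mulrA -rscalarM mulVf // mul1r.
rewrite /hermitian !conjtrM (hermitianX _ A_herm) (padj_sum_mx_herm M_herm).
rewrite conjtr_rscalar comm_rscalar; congr (_ * _).
by apply/commr_sym/commrX/commr_sym.
Qed.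

End Drazin.

End HermitianDrazin.

(** * The column and row representations *)

Lemma conjtr_replace_col (R : realType) n (M : 'M[quat R]_n) j (b : 'cV_n) :
  conjtr (replace_col M j b) = replace_row (conjtr M) j (conjtr b).
Proof. by apply/matrixP => p q; rewrite !mxE; case: eqP. Qed.

Theorem theorem3p2 (R : realType) (n k r : nat) (A : 'M[quat R]_n)
    (A_herm : hermitian A) (A_index : qindex A = k)
    (rank_Ak1 : qrank (A ^+ k.+1) = r) (rank_Ak : qrank (A ^+ k) = r)
    (r_ge1 : (1 <= r)%N) (i j : 'I_n) :
  drazin A i j =
    (\sum_(beta : {set 'I_n} | (#|beta| == r) && (i \in beta))
        cdet beta i (replace_col (A ^+ k.+1) i (col j (A ^+ k))))
    / qreal (\sum_(beta : {set 'I_n} | #|beta| == r) hdet beta (A ^+ k.+1))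
  /\
  drazin A i j =
    (\sum_(alpha : {set 'I_n} | (#|alpha| == r) && (j \in alpha))
        rdet alpha j (replace_row (A ^+ k.+1) j (row i (A ^+ k))))
    / qreal (\sum_(alpha : {set 'I_n} | #|alpha| == r) hdet alpha (A ^+ k.+1)).
Proof.
have Ak_herm := hermitianX k A_herm; have M_herm := hermitianX k.+1 A_herm.
have drazinP : is_drazin A (drazin A).
  rewrite /drazin; case: xgetP => [X _ //|noX].
  have [X hX] := herm_drazin_exists A_herm (etrans rank_Ak1 (esym rank_Ak)).
  by case: (noX X); rewrite /is_drazin A_index.
have [AkX XAX AX] : [/\ A ^+ k.+1 *m drazin A = A ^+ k,
    drazin A *m A *m drazin A = drazin A & A *m drazin A = drazin A *m A].
  by move: drazinP; rewrite /is_drazin A_index.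
have [dr drX] := drazin_eq A_herm AkX XAX AX rank_Ak.
have X_herm := drazin_herm A_herm AkX XAX AX.
have -> : \sum_(beta : {set 'I_n} | #|beta| == r) hdet beta (A ^+ k.+1)
    = pdet_sum (A ^+ k.+1) r.
  (* Here [r_ge1] excludes the empty set. *)
  apply: eq_bigr => beta /eqP br; apply: hdetE => //.
  by rewrite -card_gt0 br.
set d := pdet_sum _ _ in dr drX *.
have colP p q : drazin A p q =
    (\sum_(beta : {set 'I_n} | (#|beta| == r) && (p \in beta))
        cdet beta p (replace_col (A ^+ k.+1) p (col q (A ^+ k)))) / qreal d.
  have dU : qreal d \is a GRing.unit.
    by apply: rmorph_unit; rewrite unitfE.
  apply: (mulIr dU); rewrite mulrVK // -qrealC.
  have := congr1 (fun Z : 'M_n => Z p q) drX.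
  rewrite -mulmxE mul_scalar_mx mxE => ->.
  rewrite padj_sum_mx_mulE; apply: eq_bigr => beta /andP[_ pb].
  by rewrite cdet_padj //; apply: eq_bigr => t _; rewrite mxE.
split; first exact: colP.
(* The Drazin inverse is Hermitian, so the row formula is the conjugate of the column formula for
   the entry [j i]. *)
rewrite -[in LHS]X_herm conjtrE colP -(rmorphV (@qreal R)) /= ?unitfE //.
rewrite qconjM qconj_real qrealC raddf_sum; congr (_ * _); apply: eq_bigr => beta _ /=.
rewrite qconj_cdet conjtr_replace_col M_herm; congr (rdet _ _ (replace_row _ _ _)).
by apply/matrixP => p q; rewrite conjtrE mxE herm_entry // mxE.
Qed.
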